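(* Let $p$ be a prime, let $k$ be a $C_p$-Tambara field, and suppose $C_p$ acts nontrivially on $k(C_p/e)$. Then the canonical map $k \to \underline{k(C_p/e)}$ is an isomorphism of $C_p$-Tambara functors.
   Context: For a finite group $G$, a $G$-Tambara functor $k$ assigns to each finite $G$-set $X$ a commutative ring $k(X)$ (taking disjoint unions to products) and to each map $X \to Y$ of finite $G$-sets a restriction $k(Y)\to k(X)$ (a ring map), an additive transfer $k(X)\to k(Y)$ and a multiplicative norm $k(X)\to k(Y)$, satisfying the standard axioms (as in Tambara, Strickland). The group $G$ acts on $k(G/e)$. A nonzero $G$-Tambara functor $k$ is a $G$-Tambara field (field-like) if every morphism $k \to \ell$ with $\ell \neq 0$ is monic. (Nakaoka: equivalently, all restriction maps of $k$ are injective and $k(G/e)$ is nonzero with no nontrivial $G$-invariant ideals.) For a commutative ring $R$ with $G$-action, the fixed-point Tambara functor $\underline{R}$ has $\underline{R}(G/H)=R^H$, with restrictions the inclusions and transfers (resp. norms) the sums (resp. products) over cosets. The functor $R\mapsto\underline R$ is right adjoint to $k\mapsto k(G/e)$, and the canonical map $k\to\underline{k(G/e)}$ is the unit of this adjunction, given at level $G/H$ by the restriction $k(G/H)\to k(G/e)^H$. *)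

(* Defs.v *)
From HB Require Import structures.
From mathcomp Require Import all_boot all_algebra all_fingroup.

Set Implicit Arguments.
Unset Strict Implicit.
Unset Printing Implicit Defensive.

Import GRing.Theory.
Local Open Scope ring_scope.

(* Conventions: as for the actions of the library, groups act on the right.
   Left actions become right actions through g |-> g^-1. Rings are commutative
   and may be zero (comPzRingType): Tambara functors vanish at the empty set. *)

Record gset (gT : finGroupType) := Gset {
  gset_sort :> finType;
  gset_act : {action gT &-> gset_sort}
}.

Definition gact (gT : finGroupType) (X : gset gT) (x : X) (g : gT) : X :=
  gset_act X x g.

Lemma gact1 (gT : finGroupType) (X : gset gT) (x : X) : gact x 1%g = x.
Proof. exact: act1. Qed.

Lemma gactM (gT : finGroupType) (X : gset gT) (x : X) g h :
  gact x (g * h)%g = gact (gact x g) h.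
Proof. exact: actM. Qed.

Record gmap (gT : finGroupType) (X Y : gset gT) := Gmap {
  gmap_fun :> X -> Y;
  gmapJ : forall x g, gmap_fun (gact x g) = gact (gmap_fun x) g
}.

(* Z is the disjoint union of the X i, with inclusions j i. *)
Definition disjoint_union (I : Type) (X : I -> Type) (Z : Type)
    (j : forall i, X i -> Z) : Prop :=
  forall z, exists! t : {i : I & X i}, j (tag t) (tagged t) = z.

(*        v
     P ------> Y
     |         |
   u |         | g      is a pullback square
     v         v
     X ------> Z
          f                                                                   *)
Definition pullback (P X Y Z : Type)
    (u : P -> X) (v : P -> Y) (f : X -> Z) (g : Y -> Z) : Prop :=
  (forall w, f (u w) = g (v w)) /\
  (forall x y, f x = g y -> exists! w, u w = x /\ v w = y).

(*          q         e
       X <----- A <------ B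
       |                  |
     f |                  | f'
       v                  v
       Y <--------------- P
                q'
   is an exponential diagram: P is the dependent product of A along f, that is,
   the set of the pairs (y, s) with y in Y and s a section of q over the fibre
   f^-1(y); B is the fibre product of X and P over Y, and e (x, (y, s)) = s x.
   This describes the diagram up to isomorphism; when the maps are
   equivariant, so is the bijection of P with the set of the pairs (y, s),
   on which G acts by (y, s) g = (y g, x |-> s (x g^-1) g).                   *)
Definition exponential (A B X Y P : finType)
    (q : A -> X) (e : B -> A) (f : X -> Y) (f' : B -> P) (q' : P -> Y) : Prop :=
  pullback (q \o e) f' f q' /\
  (forall (y : Y) (s : {x : X | f x == y} -> A),
     (forall x, q (s x) = val x) ->
     exists! t : P, q' t = y /\
       forall b x, f' b = t -> q (e b) = val x -> e b = s x).

(* Functoriality is stated up to pointwise equality of maps, so that it also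
   expresses that res, tr and nm depend only on the values of a map.          *)
Record tambara (gT : finGroupType) := Tambara {
  tamb :> gset gT -> comPzRingType;
  res : forall X Y : gset gT, gmap X Y -> {rmorphism tamb Y -> tamb X};
  tr : forall X Y : gset gT, gmap X Y -> {additive tamb X -> tamb Y};
  nm : forall X Y : gset gT, gmap X Y -> tamb X -> tamb Y;
  nm_monoid : forall (X Y : gset gT) (f : gmap X Y), monoid_morphism (nm f);
  res_id : forall (X : gset gT) (f : gmap X X), f =1 id -> res f =1 id;
  tr_id : forall (X : gset gT) (f : gmap X X), f =1 id -> tr f =1 id;
  nm_id : forall (X : gset gT) (f : gmap X X), f =1 id -> nm f =1 id;
  res_comp : forall (X Y Z : gset gT)
    (f : gmap X Y) (g : gmap Y Z) (h : gmap X Z),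
    h =1 g \o f -> res h =1 res f \o res g;
  tr_comp : forall (X Y Z : gset gT)
    (f : gmap X Y) (g : gmap Y Z) (h : gmap X Z),
    h =1 g \o f -> tr h =1 tr g \o tr f;
  nm_comp : forall (X Y Z : gset gT)
    (f : gmap X Y) (g : gmap Y Z) (h : gmap X Z),
    h =1 g \o f -> nm h =1 nm g \o nm f;
  tamb_union : forall (I : finType) (X : I -> gset gT) (Z : gset gT)
    (j : forall i, gmap (X i) Z), disjoint_union j ->
    forall a : forall i, tamb (X i),
    exists! b : tamb Z, forall i, res (j i) b = a i;
  tr_pullback : forall (P X Y Z : gset gT)
    (u : gmap P X) (v : gmap P Y) (f : gmap X Z) (g : gmap Y Z),
    pullback u v f g -> res g \o tr f =1 tr v \o res u;
  nm_pullback : forall (P X Y Z : gset gT)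
    (u : gmap P X) (v : gmap P Y) (f : gmap X Z) (g : gmap Y Z),
    pullback u v f g -> res g \o nm f =1 nm v \o res u;
  nm_tr : forall (A B X Y P : gset gT) (q : gmap A X) (e : gmap B A)
    (f : gmap X Y) (f' : gmap B P) (q' : gmap P Y),
    exponential q e f f' q' -> nm f \o tr q =1 tr q' \o nm f' \o res e
}.

Arguments res {gT} k {X Y} f : rename.
Arguments tr {gT} k {X Y} f : rename.
Arguments nm {gT} k {X Y} f : rename.
Arguments nm_monoid {gT} k {X Y} f : rename.
Arguments tr_pullback {gT} k {P X Y Z u v f g} _ _ : rename.
Arguments nm_pullback {gT} k {P X Y Z u v f g} _ _ : rename.

Record tmorph (gT : finGroupType) (k l : tambara gT) := Tmorph {
  tmap :> forall X : gset gT, {rmorphism k X -> l X};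
  tmap_res : forall (X Y : gset gT) (f : gmap X Y) (a : k Y),
    tmap X (res k f a) = res l f (tmap Y a);
  tmap_tr : forall (X Y : gset gT) (f : gmap X Y) (a : k X),
    tmap Y (tr k f a) = tr l f (tmap X a);
  tmap_nm : forall (X Y : gset gT) (f : gmap X Y) (a : k X),
    tmap Y (nm k f a) = nm l f (tmap X a)
}.

Definition tmonic (gT : finGroupType) (k l : tambara gT) (phi : tmorph k l) :=
  forall (m : tambara gT) (alpha beta : tmorph m k),
    (forall (X : gset gT) (a : m X),
       phi X (alpha X a) = phi X (beta X a)) ->
    forall (X : gset gT) (a : m X), alpha X a = beta X a.

Definition tiso (gT : finGroupType) (k l : tambara gT) (phi : tmorph k l) :=
  exists psi : tmorph l k,
    (forall X : gset gT, cancel (phi X) (psi X)) /\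
    (forall X : gset gT, cancel (psi X) (phi X)).

Definition tnonzero (gT : finGroupType) (k : tambara gT) : Prop :=
  exists X : gset gT, (1 : k X) <> 0.

Definition tambara_field (gT : finGroupType) (k : tambara gT) : Prop :=
  tnonzero k /\
  forall (l : tambara gT) (phi : tmorph k l), tnonzero l -> tmonic phi.

Record gring (gT : finGroupType) := Gring {
  gring_sort :> comPzRingType;
  gring_act : gT -> {rmorphism gring_sort -> gring_sort};
  gring_act1 : forall a, gring_act 1%g a = a;
  gring_actM : forall g h a, gring_act (g * h)%g a = gring_act h (gring_act g a)
}.

Section FixedPoint.
Variables (gT : finGroupType) (R : gring gT).

(* The fixed-point functor sends X to the ring of equivariant maps X -> R.
   If X is the orbit G/H this is R^H, by evaluation at the base point; see
   fixed_orbit below. *)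
Definition equivariant (X : gset gT) : {pred {ffun X -> R}} :=
  fun phi => [forall x, forall g, phi (gact x g) == gring_act R g (phi x)].

Arguments equivariant : clear implicits.

Lemma equivariantP (X : gset gT) (phi : {ffun X -> R}) :
  reflect (forall x g, phi (gact x g) = gring_act R g (phi x))
          (phi \in equivariant X).
Proof.
apply: (iffP forallP) => H x; last by apply/forallP=> g; apply/eqP/H.
by move=> g; apply/eqP; move/forallP: (H x); apply.
Qed.

Fact equivariant_subring (X : gset gT) : subring_closed (equivariant X).
Proof.
split=> [|a b /equivariantP Ha /equivariantP Hb|
          a b /equivariantP Ha /equivariantP Hb];
  apply/equivariantP=> x g; rewrite !ffunE.
- by rewrite rmorph1.
- by rewrite Ha Hb rmorphB.
- by rewrite Ha Hb rmorphM.
Qed.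

Record fixed_sort (X : gset gT) := Fixed {
  fixed_val : {ffun X -> R};
  _ : fixed_val \in equivariant X
}.

HB.instance Definition _ X := [isSub for @fixed_val X].
HB.instance Definition _ X := [Choice of fixed_sort X by <:].
HB.instance Definition _ X :=
  GRing.SubChoice_isSubPzRing.Build _ _ (fixed_sort X) (equivariant_subring X).

Fact fixed_mulC (X : gset gT) : commutative (@GRing.mul (fixed_sort X)).
Proof.
by move=> a b; apply/val_inj/ffunP=> x; rewrite !rmorphM /= !ffunE mulrC.
Qed.

HB.instance Definition _ X :=
  GRing.PzRing_hasCommutativeMul.Build (fixed_sort X) (@fixed_mulC X).

Lemma fixedJ (X : gset gT) (phi : fixed_sort X) x g :
  fixed_val phi (gact x g) = gring_act R g (fixed_val phi x).
Proof. by case: phi => phi /= /equivariantP. Qed.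

Lemma fixedP (X : gset gT) (phi psi : fixed_sort X) :
  fixed_val phi =1 fixed_val psi -> phi = psi.
Proof. by move=> H; apply/val_inj/ffunP. Qed.

Lemma fixed_orbit (X : gset gT) (x : X) (r : R) :
  (forall y, exists g, gact x g = y) ->
  (forall g, gact x g = x -> gring_act R g r = r) ->
  exists! phi : fixed_sort X, fixed_val phi x = r.
Proof.
move=> transX fixr.
have trans_ex y : exists g, gact x g == y.
  by have [g <-] := transX y; exists g.
pose t y := xchoose (trans_ex y).
have tP y : gact x (t y) = y by apply/eqP; exact: (xchooseP (trans_ex y)).
have phiE g : gring_act R (t (gact x g)) r = gring_act R g r.
  have fx : gact x (t (gact x g) * g^-1)%g = x.
    by rewrite gactM tP -gactM mulgV gact1.
  by rewrite -{2}(fixr _ fx) -gring_actM mulgKV.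
have phi_eq : [ffun y => gring_act R (t y) r] \in equivariant X.
  apply/equivariantP=> y g; rewrite !ffunE -gring_actM -(phiE (t y * g)%g).
  by rewrite gactM tP.
exists (Fixed phi_eq); split=> [|psi psix].
  rewrite /= ffunE; have := phiE 1%g.
  by rewrite gact1 gring_act1.
apply: fixedP => y; rewrite /= ffunE -psix -fixedJ.
by rewrite tP.
Qed.

Lemma fib_reindex (X Y : gset gT) (f : gmap X Y) (y : Y) (g : gT)
    (S : Type) (idx : S) (op : Monoid.com_law idx) (F : X -> S) :
  \big[op/idx]_(x | f x == gact y g) F x =
  \big[op/idx]_(x | f x == y) F (gact x g).
Proof.
rewrite (reindex (fun x : X => gact x g)) /=.
  apply: eq_bigl => x; rewrite gmapJ.
  by rewrite /gact (inj_eq (act_inj _ _)).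
exists (fun x : X => gact x g^-1%g) => x _; rewrite /gact ?actK ?actKV //.
Qed.

Section Maps.
Variables (X Y : gset gT) (f : gmap X Y).

Fact fixed_res_subproof (phi : fixed_sort Y) :
  [ffun x => fixed_val phi (f x)] \in equivariant X.
Proof. by apply/equivariantP=> x g; rewrite !ffunE gmapJ fixedJ. Qed.

Definition fixed_res phi := Fixed (fixed_res_subproof phi).

Fact fixed_tr_subproof (phi : fixed_sort X) :
  [ffun y => \sum_(x | f x == y) fixed_val phi x] \in equivariant Y.
Proof.
apply/equivariantP=> y g; rewrite !ffunE fib_reindex rmorph_sum /=.
by apply: eq_bigr => x _; rewrite fixedJ.
Qed.

Definition fixed_tr phi := Fixed (fixed_tr_subproof phi).

Fact fixed_nm_subproof (phi : fixed_sort X) :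
  [ffun y => \prod_(x | f x == y) fixed_val phi x] \in equivariant Y.
Proof.
apply/equivariantP=> y g; rewrite !ffunE fib_reindex rmorph_prod /=.
by apply: eq_bigr => x _; rewrite fixedJ.
Qed.

Definition fixed_nm phi := Fixed (fixed_nm_subproof phi).

Fact fixed_res_zmod : zmod_morphism fixed_res.
Proof. by move=> a b; apply: fixedP => x; rewrite /= !ffunE. Qed.

Fact fixed_res_monoid : monoid_morphism fixed_res.
Proof. by split=> [|a b]; apply: fixedP => x; rewrite /= !ffunE. Qed.

HB.instance Definition _ :=
  GRing.isZmodMorphism.Build _ _ fixed_res fixed_res_zmod.
HB.instance Definition _ :=
  GRing.isMonoidMorphism.Build _ _ fixed_res fixed_res_monoid.

Fact fixed_tr_zmod : zmod_morphism fixed_tr.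
Proof.
move=> a b; apply: fixedP => x; rewrite /= !ffunE -sumrB.
by apply: eq_bigr => y _; rewrite !ffunE.
Qed.

HB.instance Definition _ :=
  GRing.isZmodMorphism.Build _ _ fixed_tr fixed_tr_zmod.

Fact fixed_nm_monoid : monoid_morphism fixed_nm.
Proof.
split=> [|a b]; apply: fixedP => x; rewrite /= !ffunE.
  by apply: big1 => y _; rewrite ffunE.
by rewrite -big_split; apply: eq_bigr => y _; rewrite ffunE.
Qed.
End Maps.

Fact fixed_res_id (X : gset gT) (f : gmap X X) :
  f =1 id -> fixed_res f =1 id.
Proof. by move=> fE a; apply: fixedP => x; rewrite /= ffunE fE. Qed.

Fact fixed_tr_id (X : gset gT) (f : gmap X X) : f =1 id -> fixed_tr f =1 id.
Proof.
move=> fE a; apply: fixedP => x; rewrite /= ffunE.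
by under eq_bigl do rewrite fE; rewrite big_pred1_eq.
Qed.

Fact fixed_nm_id (X : gset gT) (f : gmap X X) : f =1 id -> fixed_nm f =1 id.
Proof.
move=> fE a; apply: fixedP => x; rewrite /= ffunE.
by under eq_bigl do rewrite fE; rewrite big_pred1_eq.
Qed.

Section Comp.
Variables (X Y Z : gset gT) (f : gmap X Y) (g : gmap Y Z) (h : gmap X Z).
Hypothesis hE : h =1 g \o f.

Fact fixed_res_comp : fixed_res h =1 fixed_res f \o fixed_res g.
Proof. by move=> a; apply: fixedP => x; rewrite /= !ffunE hE. Qed.

Let fib_comp (S : Type) (idx : S) (op : Monoid.com_law idx) (F : X -> S) z :
  \big[op/idx]_(x | h x == z) F x =
  \big[op/idx]_(y | g y == z) \big[op/idx]_(x | f x == y) F x.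
Proof.
rewrite (partition_big f (fun y => g y == z)) => [|x]; last by rewrite hE.
apply: eq_bigr => y /eqP gy; apply: eq_bigl => x.
by case: (f x =P y) => [fx|]; rewrite ?andbF // hE /= fx gy eqxx.
Qed.

Fact fixed_tr_comp : fixed_tr h =1 fixed_tr g \o fixed_tr f.
Proof.
move=> a; apply: fixedP => z; rewrite /= !ffunE fib_comp.
by apply: eq_bigr => y _; rewrite ffunE.
Qed.

Fact fixed_nm_comp : fixed_nm h =1 fixed_nm g \o fixed_nm f.
Proof.
move=> a; apply: fixedP => z; rewrite /= !ffunE fib_comp.
by apply: eq_bigr => y _; rewrite ffunE.
Qed.
End Comp.

Fact fixed_union (I : finType) (X : I -> gset gT) (Z : gset gT)
    (j : forall i, gmap (X i) Z) : disjoint_union j ->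
  forall a : forall i, fixed_sort (X i),
  exists! b : fixed_sort Z, forall i, fixed_res (j i) b = a i.
Proof.
move=> dj a.
have ex z : exists t : {i : I & X i}, j (tag t) (tagged t) == z.
  by have [t [<- _]] := dj z; exists t.
pose t z := xchoose (ex z).
have tP z : j (tag (t z)) (tagged (t z)) = z.
  by apply/eqP; exact: (xchooseP (ex z)).
have tE i (x : X i) : t (j i x) = Tagged (fun i => X i) x.
  by have [s [_ u]] := dj (j i x); rewrite -(u _ (tP _)); apply: u.
have bE : [ffun z => fixed_val (a (tag (t z))) (tagged (t z))]
    \in equivariant Z.
  apply/equivariantP=> z g; rewrite !ffunE -fixedJ.
  have -> // : t (gact z g) =
      Tagged (fun i => X i) (gact (tagged (t z)) g).
  by rewrite -tE gmapJ tP.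
exists (Fixed bE); split=> [i|b' Hb'].
  by apply: fixedP => x; rewrite /= !ffunE tE.
apply: fixedP => z; rewrite /= ffunE -Hb' /= ffunE.
by rewrite tP.
Qed.

Section Pullback.
Variables (P X Y Z : gset gT).
Variables (u : gmap P X) (v : gmap P Y) (f : gmap X Z) (g : gmap Y Z).
Hypothesis pb : pullback u v f g.

Let fib_pullback (S : Type) (idx : S) (op : Monoid.com_law idx) (F : X -> S) y :
  \big[op/idx]_(x | f x == g y) F x = \big[op/idx]_(w | v w == y) F (u w).
Proof.
rewrite (reindex_omap u (fun x => [pick w | (u w == x) && (v w == y)])).
  apply: eq_bigl => w; apply/andP/eqP => [[_]|vw].
    case: pickP => // w' /andP[/eqP uw' /eqP vw'] /eqP[<-].
    exact: vw'.
  split; first by rewrite pb.1 vw.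
  case: pickP => [w' /andP[/eqP uw' /eqP vw']|/(_ w)]; last by rewrite vw !eqxx.
  have [w0 [_ w0P]] := pb.2 (u w) y (etrans (pb.1 w) (congr1 g vw)).
  by rewrite -(w0P w') // -(w0P w).
move=> x /eqP fx; have [w [[uw vw] _]] := pb.2 _ _ fx.
case: pickP => [w' /andP[/eqP /= -> _] //|/(_ w)].
by rewrite uw vw !eqxx.
Qed.

Fact fixed_tr_pullback : fixed_res g \o fixed_tr f =1 fixed_tr v \o fixed_res u.
Proof.
move=> a; apply: fixedP => y; rewrite /= !ffunE fib_pullback.
by apply: eq_bigr => w _; rewrite ffunE.
Qed.

Fact fixed_nm_pullback : fixed_res g \o fixed_nm f =1 fixed_nm v \o fixed_res u.
Proof.
move=> a; apply: fixedP => y; rewrite /= !ffunE fib_pullback.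
by apply: eq_bigr => w _; rewrite ffunE.
Qed.
End Pullback.

Fact fixed_nm_tr (A B X Y P : gset gT) (q : gmap A X) (e : gmap B A)
    (f : gmap X Y) (f' : gmap B P) (q' : gmap P Y) :
  exponential q e f f' q' ->
  fixed_nm f \o fixed_tr q =1 fixed_tr q' \o fixed_nm f' \o fixed_res e.
Proof.
move=> [[sq pb] sec] a; apply: fixedP => y; rewrite /= !ffunE.
pose T := {t : P | q' t == y}; pose I := {x : X | f x == y}.
have bex (t : T) (x : I) : exists b, (q (e b) == val x) && (f' b == val t).
  have [|b [[/= qb fb] _]] := pb (val x) (val t).
    by rewrite (eqP (valP x)) (eqP (valP t)).
  by exists b; rewrite qb fb !eqxx.
pose b t x := xchoose (bex t x).
have bP t x : q (e (b t x)) = val x /\ f' (b t x) = val t.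
  by have /andP[/eqP-> /eqP->] := xchooseP (bex t x).
have bE t x b' : q (e b') = val x -> f' b' = val t -> b' = b t x.
  move=> qb' fb'; have [|b0 [_ b0P]] := pb (val x) (val t).
    by rewrite (eqP (valP x)) (eqP (valP t)).
  exact: etrans (esym (b0P _ (conj qb' fb'))) (b0P _ (bP t x)).
pose h (t : T) := [ffun x : I => e (b t x)].
have h_sec t : h t \in family (fun x : I => [pred c | q c == val x]).
  by apply/familyP => x; rewrite ffunE inE (bP t x).1 eqxx.
have h_inj : injective h.
  move=> t1 t2 Eh; apply: val_inj.
  have [|t [_ tP]] := sec y (h t1).
    by move=> x; rewrite ffunE (bP t1 x).1.
  have ht (t' : T) : h t' = h t1 -> t = val t'.
    move=> E; apply: tP; split=> [|b' x fb' qb']; first exact/eqP/(valP t').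
    by rewrite -E ffunE (bE t' x b').
  by rewrite -(ht t1) // (ht t2).
have h_surj s : s \in family (fun x : I => [pred c | q c == val x]) ->
    exists t, h t == s.
  move=> /familyP sP; have [x|t [[/eqP qt tP] _]] := sec y s.
    exact/eqP/(sP x).
  exists (Sub t qt); apply/eqP/ffunP=> x; rewrite ffunE.
  by have [qb fb] := bP (Sub t qt) x; rewrite (tP _ x fb qb).
transitivity (\prod_(x : I) \sum_(c | q c == val x) fixed_val a c).
  rewrite (big_sub [pred x | f x == y]) /=.
  by apply: eq_bigr => x _; rewrite ffunE.
rewrite (bigA_distr_big_dep (fun x : I => [pred c | q c == val x])).
rewrite (big_sub [pred t | q' t == y]) /=.
rewrite (reindex_omap h (fun s => [pick t | h t == s])) /=; last first.
  move=> s /h_surj[t /eqP ht]; case: pickP => [t' /eqP /= -> //|/(_ t)].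
  by rewrite ht eqxx.
apply: eq_big => [t|t _].
  rewrite h_sec /=; case: pickP => [t' /eqP/h_inj->|/(_ t)]; by rewrite eqxx.
rewrite ffunE (reindex_omap (b t) (fun b' => insub (q (e b')))) /=.
  apply: eq_big => [x|x _]; last by rewrite !ffunE.
  by have [-> ->] := bP t x; rewrite valK !eqxx.
move=> b' /eqP fb'; case: insubP => [x _ /= xE|/negP[]].
  by rewrite -(bE t x b').
by have /= -> := sq b'; rewrite fb' (valP t).
Qed.

Definition fixed : tambara gT := @Tambara gT
  (fun X => fixed_sort X : comPzRingType)
  (fun X Y f => fixed_res f) (fun X Y f => fixed_tr f) fixed_nm fixed_nm_monoid
  fixed_res_id fixed_tr_id fixed_nm_id fixed_res_comp fixed_tr_comp
  fixed_nm_comp fixed_union fixed_tr_pullback fixed_nm_pullback fixed_nm_tr.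

End FixedPoint.

Arguments equivariant {gT} R X _.

(* G/e, and the map G/e -> X sending the base point to x. *)
Definition gfree (gT : finGroupType) : gset gT := Gset 'R%act.

Definition orb (gT : finGroupType) (X : gset gT) (x : X) : gmap (gfree gT) X :=
  @Gmap gT (gfree gT) X (gact x) (gactM x).

Definition gid (gT : finGroupType) (X : gset gT) : gmap X X :=
  @Gmap gT X X id (fun x g => erefl).

Definition gempty (gT : finGroupType) : gset gT :=
  Gset (@TotalAction gT void (fun v _ => v) (fun v => erefl)
    (fun v g h => erefl)).

Definition gempty_map (gT : finGroupType) (X : gset gT) : gmap (gempty gT) X :=
  @Gmap gT (gempty gT) X (of_void X) (fun v => match v with end).

Lemma gempty_eq (gT : finGroupType) (k : tambara gT) (a b : k (gempty gT)) :
  a = b.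
Proof.
have [|c [_ cP]] := @tamb_union gT k void (of_void _) (gempty gT)
  (fun i => match i with end) _ (fun i => match i with end); first by case.
by rewrite -(cP a) ?(cP b) //; case.
Qed.

Section Unit.
Variables (gT : finGroupType) (k : tambara gT).

(* g in G acts on k(G/e) by restriction along the automorphism h |-> g h of
   the G-set G/e. *)
Definition free_res (g : gT) : {rmorphism k (gfree gT) -> k (gfree gT)} :=
  res k (@orb gT (gfree gT) g).

Fact free_res1 a : free_res 1%g a = a.
Proof. by apply: res_id => h; apply: mul1g. Qed.

Fact free_resM g h a : free_res (g * h)%g a = free_res h (free_res g a).
Proof. by apply: res_comp => u; rewrite /= /gact /= mulgA. Qed.

Definition underlying : gring gT := Gring free_res1 free_resM.

Lemma res_orbJ (X : gset gT) (x : X) (g : gT) (a : k X) :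
  res k (orb (gact x g)) a = gring_act underlying g (res k (orb x) a).
Proof. by apply: res_comp => u; rewrite /= -gactM. Qed.

Fact tunit_subproof (X : gset gT) (a : k X) :
  [ffun x => res k (orb x) a : underlying] \in equivariant underlying X.
Proof. by apply/equivariantP=> x g; rewrite !ffunE res_orbJ. Qed.

(* At X = G/H, evaluation at the base point identifies tunit_map X with the
   restriction k(G/H) -> k(G/e)^H. *)
Definition tunit_map (X : gset gT) (a : k X) : fixed underlying X :=
  Fixed (tunit_subproof a).

Fact tunit_zmod X : zmod_morphism (@tunit_map X).
Proof. by move=> a b; apply: fixedP => x; rewrite /= !ffunE rmorphB. Qed.

Fact tunit_monoid X : monoid_morphism (@tunit_map X).
Proof.
by split=> [|a b]; apply: fixedP => x; rewrite /= !ffunE (rmorph1, rmorphM).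
Qed.

HB.instance Definition _ X :=
  GRing.isZmodMorphism.Build _ _ (@tunit_map X) (@tunit_zmod X).
HB.instance Definition _ X :=
  GRing.isMonoidMorphism.Build _ _ (@tunit_map X) (@tunit_monoid X).

Fact tunit_res (X Y : gset gT) (f : gmap X Y) (a : k Y) :
  tunit_map (res k f a) = res (fixed underlying) f (tunit_map a).
Proof.
apply: fixedP => x; rewrite /= !ffunE.
by apply/esym/res_comp => g; rewrite /= gmapJ.
Qed.

Section Fibre.
Variables (X Y : gset gT) (f : gmap X Y) (y : Y).
Let F := {x : X | f x == y}.

Definition fibre_act (w : F * gT) (g : gT) : F * gT := (w.1, (w.2 * g)%g).

Fact fibre_act_id : fibre_act^~ 1%g =1 id.
Proof. by case=> x g; rewrite /fibre_act mulg1. Qed.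

Fact fibre_actM w : act_morph fibre_act w.
Proof. by move=> g h; rewrite /fibre_act /= mulgA. Qed.

(* The fibre product of X and G/e over Y is the disjoint union of the copies
   {x} x G of G/e, for x in the fibre of f over y. *)
Definition fibre : gset gT :=
  Gset (TotalAction fibre_act_id fibre_actM).

Definition fibre_inj (x : F) : gmap (gfree gT) fibre :=
  @Gmap gT (gfree gT) fibre (fun g => (x, g)) (fun g h => erefl).

Definition fibre_fst : gmap fibre X :=
  @Gmap gT fibre X (fun w : F * gT => gact (val w.1) w.2)
    (fun w h => gactM (val w.1) w.2 h).

Definition fibre_snd : gmap fibre (gfree gT) :=
  @Gmap gT fibre (gfree gT) (fun w : F * gT => w.2) (fun w h => erefl).

Fact fibre_pullback : pullback fibre_fst fibre_snd f (orb y).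
Proof.
split=> [[x g]|x g fx]; rewrite /= ?gmapJ ?(eqP (valP x)) //.
have fx' : f (gact x g^-1%g) == y.
  by rewrite gmapJ fx /= -gactM mulgV gact1.
exists (Sub (gact x g^-1%g) fx', g); split=> [|[x' g'] /= [xE gE]].
  by rewrite /= -gactM mulVg gact1.
apply: injective_projections => //=.
by apply: val_inj; rewrite /= -xE gE -gactM mulgV gact1.
Qed.

Fact fibre_union : disjoint_union fibre_inj.
Proof.
move=> [x g]; exists (existT (fun _ : F => gset_sort (gfree gT)) x g).
by split=> [//|[x' g'] [-> ->]].
Qed.

Lemma fibre_inj_pullback x :
  pullback (gid (gfree gT)) (gid (gfree gT)) (fibre_inj x) (fibre_inj x).
Proof.
by split=> [//|g h [<-]]; exists g; split=> [//|w [<-]].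
Qed.

Lemma fibre_inj_pullback0 x x' : x != x' ->
  pullback (gempty_map (gfree gT)) (gempty_map (gfree gT))
    (fibre_inj x) (fibre_inj x').
Proof. by move=> /eqP xx'; split=> [[]|g h [/xx']]. Qed.

Lemma fibre_ext (a b : k fibre) :
  (forall x, res k (fibre_inj x) a = res k (fibre_inj x) b) -> a = b.
Proof.
move=> E; have [c [_ cP]] :=
  tamb_union fibre_union (fun x => res k (fibre_inj x) b).
by rewrite -(cP a) // -(cP b).
Qed.

Lemma tr_fibre_snd (b : k fibre) :
  tr k fibre_snd b = \sum_(x : F) res k (fibre_inj x) b.
Proof.
have {1}-> : b = \sum_(x : F) tr k (fibre_inj x) (res k (fibre_inj x) b).
  apply: fibre_ext => x; rewrite rmorph_sum (bigD1 x) //= big1 => [|x' nx'].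
    have /= -> := tr_pullback k (fibre_inj_pullback x) (res k (fibre_inj x) b).
    by rewrite addr0 tr_id // res_id.
  have /= -> := tr_pullback k (fibre_inj_pullback0 nx')
    (res k (fibre_inj x') b).
  by rewrite [res _ _ _](gempty_eq _ 0) raddf0.
rewrite raddf_sum; apply: eq_bigr => x _.
by rewrite -[LHS](@tr_comp _ k _ _ _ _ _ (gid _)) // tr_id.
Qed.

Lemma nm_fibre_snd (b : k fibre) :
  nm k fibre_snd b = \prod_(x : F) res k (fibre_inj x) b.
Proof.
have {1}-> : b = \prod_(x : F) nm k (fibre_inj x) (res k (fibre_inj x) b).
  apply: fibre_ext => x; rewrite rmorph_prod (bigD1 x) //= big1 => [|x' nx'].
    have /= -> := nm_pullback k (fibre_inj_pullback x) (res k (fibre_inj x) b).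
    by rewrite mulr1 nm_id // res_id.
  have /= -> := nm_pullback k (fibre_inj_pullback0 nx')
    (res k (fibre_inj x') b).
  by rewrite [res _ _ _](gempty_eq _ 1) (nm_monoid k _).1.
rewrite (big_morph _ (nm_monoid k fibre_snd).2 (nm_monoid k fibre_snd).1).
apply: eq_bigr => x _.
by rewrite -[LHS](@nm_comp _ k _ _ _ _ _ (gid _)) // nm_id.
Qed.

Lemma res_fibre (x : F) (a : k X) :
  res k (fibre_inj x) (res k fibre_fst a) = res k (orb (val x)) a.
Proof. exact/esym/res_comp. Qed.

Lemma res_orb_tr (a : k X) :
  res k (orb y) (tr k f a) = \sum_(x | f x == y) res k (orb x) a.
Proof.
have /= -> := tr_pullback k fibre_pullback a.
rewrite tr_fibre_snd (big_sub [pred x | f x == y]) /=.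
by apply: eq_bigr => x _; apply: res_fibre.
Qed.

Lemma res_orb_nm (a : k X) :
  res k (orb y) (nm k f a) = \prod_(x | f x == y) res k (orb x) a.
Proof.
have /= -> := nm_pullback k fibre_pullback a.
rewrite nm_fibre_snd (big_sub [pred x | f x == y]) /=.
by apply: eq_bigr => x _; apply: res_fibre.
Qed.
End Fibre.

Fact tunit_tr (X Y : gset gT) (f : gmap X Y) (a : k X) :
  tunit_map (tr k f a) = tr (fixed underlying) f (tunit_map a).
Proof.
apply: fixedP => y; rewrite /= !ffunE res_orb_tr.
by apply: eq_bigr => x _; rewrite ffunE.
Qed.

Fact tunit_nm (X Y : gset gT) (f : gmap X Y) (a : k X) :
  tunit_map (nm k f a) = nm (fixed underlying) f (tunit_map a).
Proof.
apply: fixedP => y; rewrite /= !ffunE res_orb_nm.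
by apply: eq_bigr => x _; rewrite ffunE.
Qed.

Definition tunit : tmorph k (fixed underlying) :=
  Tmorph tunit_res tunit_tr tunit_nm.
End Unit.

(* Main.v *)
From HB Require Import structures.
From mathcomp Require Import all_boot all_algebra all_fingroup.
From mathcomp Require Import cyclic generic_quotient ring_quotient boolp.
Require Import Defs.

(** A morphism of Tambara functors is an isomorphism as soon as it is bijective
    at every level, so the unit k -> fixed (k(G/e)) has to be shown injective
    and surjective; write R for k(G/e).

    Injectivity. A monic morphism is injective at every level, because its
    kernel pair is again a Tambara functor with two projections to the source
    ([tmonic_inj]). The action on R being nontrivial, R is nonzero, hence so is
    its fixed-point functor, and the unit is monic because k is a field.

    Surjectivity. For a proper G-stable ideal I of R the adjunction turns
    R -> R/I into a morphism from k to the fixed-point functor of R/I, which is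
    nonzero; it is injective and kills I at level G/e, so I = 0. Thus R has no
    G-stable ideals other than 0 and R ([field_gsimple]). As G has prime order
    it is abelian and generated by any s <> 1; so every s <> 1 acts
    nontrivially, and the elements a - a^s generate the unit ideal
    ([ideal_of_displacements]). This is the unramifiedness that makes R a Galois
    extension of its fixed ring, and an independence of characters argument,
    with R possibly not a domain, shows that the trace is not the zero map
    ([trace_neq0]). A nonzero trace t spans a G-stable ideal, hence is a unit,
    and dividing by it gives c of trace 1 ([trace_eq1]). With such a c, an
    equivariant map b : X -> R is the image of the sum over x in X of the
    transfers along G/e -> X, 1 |-> x, of c * b x ([tunit_surj]). *)

Set Implicit Arguments.
Unset Strict Implicit.
Unset Printing Implicit Defensive.

Import GRing.Theory.
Local Open Scope ring_scope.
Local Open Scope quotient_scope.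

(** * Bijective morphisms are isomorphisms *)

Section Bijective.
Variables (gT : finGroupType) (k l : tambara gT) (phi : tmorph k l).
Hypothesis phi_inj : forall X, injective (phi X).
Hypothesis phi_surj : forall X (b : l X), exists a : k X, phi X a = b.

Let preim_ex X (b : l X) : exists a : k X, phi X a == b.
Proof. by have [a <-] := phi_surj b; exists a. Qed.

Definition tinv X (b : l X) : k X := xchoose (preim_ex b).

Fact tinvK X : cancel (@tinv X) (phi X).
Proof. by move=> b; apply/eqP/(xchooseP (preim_ex b)). Qed.

Fact tmapK X : cancel (phi X) (@tinv X).
Proof. by move=> a; apply: (@phi_inj X); rewrite tinvK. Qed.

HB.instance Definition _ X := GRing.isZmodMorphism.Build _ _ (@tinv X)
  (can2_zmod_morphism (@tmapK X) (@tinvK X)).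
HB.instance Definition _ X := GRing.isMonoidMorphism.Build _ _ (@tinv X)
  (can2_monoid_morphism (@tmapK X) (@tinvK X)).

Lemma bijective_tiso : tiso phi.
Proof.
have psi_res X Y (f : gmap X Y) b : tinv (res l f b) = res k f (tinv b).
  by apply: (@phi_inj X); rewrite tmap_res !tinvK.
have psi_tr X Y (f : gmap X Y) b : tinv (tr l f b) = tr k f (tinv b).
  by apply: (@phi_inj Y); rewrite tmap_tr !tinvK.
have psi_nm X Y (f : gmap X Y) b : tinv (nm l f b) = nm k f (tinv b).
  by apply: (@phi_inj Y); rewrite tmap_nm !tinvK.
exists (Tmorph (tmap := fun X => @tinv X : {rmorphism l X -> k X})
  psi_res psi_tr psi_nm).
by split=> X; [apply: tmapK | apply: tinvK].
Qed.

End Bijective.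

(** * Kernel pairs and monomorphisms *)

Section KernelPair.
Variables (gT : finGroupType) (k l : tambara gT) (phi : tmorph k l).

Definition kpair_pred (X : gset gT) : {pred k X * k X} :=
  fun ab => phi X ab.1 == phi X ab.2.

Arguments kpair_pred : clear implicits.

Fact kpair_subring X : subring_closed (kpair_pred X).
Proof.
split=> [|a b /eqP Ha /eqP Hb|a b /eqP Ha /eqP Hb]; apply/eqP => //=.
  by rewrite !rmorphB Ha Hb.
by rewrite !rmorphM Ha Hb.
Qed.

Record kpair_sort (X : gset gT) := Kpair {
  kpair_val : k X * k X;
  _ : kpair_val \in kpair_pred X
}.

HB.instance Definition _ X := [isSub for @kpair_val X].
HB.instance Definition _ X := [Choice of kpair_sort X by <:].
HB.instance Definition _ X :=
  GRing.SubChoice_isSubComPzRing.Build _ _ (kpair_sort X) (kpair_subring X).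

Lemma kpairE X (w : kpair_sort X) :
  phi X (kpair_val w).1 = phi X (kpair_val w).2.
Proof. by case: w => w /= /eqP. Qed.

Lemma kpairP X (v w : kpair_sort X) :
  (kpair_val v).1 = (kpair_val w).1 -> (kpair_val v).2 = (kpair_val w).2 ->
  v = w.
Proof. by move=> H1 H2; apply/val_inj/injective_projections. Qed.

Definition kfst X (w : kpair_sort X) : k X := (kpair_val w).1.
Definition ksnd X (w : kpair_sort X) : k X := (kpair_val w).2.

HB.instance Definition _ X := GRing.isZmodMorphism.Build _ _ (@kfst X)
  (fun v w => erefl).
HB.instance Definition _ X := GRing.isMonoidMorphism.Build _ _ (@kfst X)
  (erefl, fun v w => erefl).
HB.instance Definition _ X := GRing.isZmodMorphism.Build _ _ (@ksnd X)
  (fun v w => erefl).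
HB.instance Definition _ X := GRing.isMonoidMorphism.Build _ _ (@ksnd X)
  (erefl, fun v w => erefl).

Section Maps.
Variables (X Y : gset gT) (f : gmap X Y).

Fact kpair_res_subproof (w : kpair_sort Y) :
  (res k f (kfst w), res k f (ksnd w)) \in kpair_pred X.
Proof. by apply/eqP; rewrite /= !tmap_res kpairE. Qed.
Definition kpair_res w := Kpair (kpair_res_subproof w).

Fact kpair_tr_subproof (w : kpair_sort X) :
  (tr k f (kfst w), tr k f (ksnd w)) \in kpair_pred Y.
Proof. by apply/eqP; rewrite /= !tmap_tr kpairE. Qed.
Definition kpair_tr w := Kpair (kpair_tr_subproof w).

Fact kpair_nm_subproof (w : kpair_sort X) :
  (nm k f (kfst w), nm k f (ksnd w)) \in kpair_pred Y.
Proof. by apply/eqP; rewrite /= !tmap_nm kpairE. Qed.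
Definition kpair_nm w := Kpair (kpair_nm_subproof w).

Fact kpair_res_zmod : zmod_morphism kpair_res.
Proof. by move=> v w; apply: kpairP; rewrite /= !rmorphB. Qed.
Fact kpair_res_monoid : monoid_morphism kpair_res.
Proof. by split=> [|v w]; apply: kpairP; rewrite /= ?rmorph1 ?rmorphM. Qed.
HB.instance Definition _ :=
  GRing.isZmodMorphism.Build _ _ kpair_res kpair_res_zmod.
HB.instance Definition _ :=
  GRing.isMonoidMorphism.Build _ _ kpair_res kpair_res_monoid.

Fact kpair_tr_zmod : zmod_morphism kpair_tr.
Proof. by move=> v w; apply: kpairP; rewrite /= !raddfB. Qed.
HB.instance Definition _ :=
  GRing.isZmodMorphism.Build _ _ kpair_tr kpair_tr_zmod.

Fact kpair_nm_monoid : monoid_morphism kpair_nm.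
Proof.
have [nm1 nmM] := nm_monoid k f.
by split=> [|v w]; apply: kpairP; rewrite /= ?rmorph1 ?rmorphM ?nm1 ?nmM.
Qed.
End Maps.

(** The gluings b1 and b2 of the two components have equal images in l, because
    both images glue the same family there. *)
Fact kpair_union (I : finType) (X : I -> gset gT) (Z : gset gT)
    (j : forall i, gmap (X i) Z) : disjoint_union j ->
  forall a : forall i, kpair_sort (X i),
  exists! b : kpair_sort Z, forall i, kpair_res (j i) b = a i.
Proof.
move=> dj a.
have [b1 [b1P b1u]] := tamb_union dj (fun i => kfst (a i)).
have [b2 [b2P b2u]] := tamb_union dj (fun i => ksnd (a i)).
have bE : (b1, b2) \in kpair_pred Z.
  have [c [_ cu]] := tamb_union dj (fun i => phi _ (kfst (a i))).
  apply/eqP; rewrite /= -(cu (phi Z b1)) => [|i]; last by rewrite -tmap_res b1P.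
  by apply: cu => i; rewrite -tmap_res b2P /ksnd -kpairE.
exists (Kpair bE); split=> [i|b' Hb'].
  by apply: kpairP; rewrite /= ?b1P ?b2P.
apply: kpairP => /=.
  by apply: b1u => i; rewrite -Hb'.
by apply: b2u => i; rewrite -Hb'.
Qed.

Definition kpair : tambara gT.
Proof.
refine (@Tambara gT (fun X => kpair_sort X : comPzRingType)
  (fun X Y f => kpair_res f) (fun X Y f => kpair_tr f) kpair_nm kpair_nm_monoid
  _ _ _ _ _ _ kpair_union _ _ _).
- by move=> X f fE w; apply: kpairP; rewrite /= res_id.
- by move=> X f fE w; apply: kpairP; rewrite /= tr_id.
- by move=> X f fE w; apply: kpairP; rewrite /= nm_id.
- by move=> X Y Z f g h hE w; apply: kpairP; exact: (res_comp hE _).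
- by move=> X Y Z f g h hE w; apply: kpairP; exact: (tr_comp hE _).
- by move=> X Y Z f g h hE w; apply: kpairP; exact: (nm_comp hE _).
- by move=> P X Y Z u v f g pb w; apply: kpairP; exact: (tr_pullback k pb _).
- by move=> P X Y Z u v f g pb w; apply: kpairP; exact: (nm_pullback k pb _).
- by move=> A B X Y P q e f f' q' ed w; apply: kpairP; exact: (nm_tr ed _).
Defined.

Definition kpair_fst : tmorph kpair k :=
  @Tmorph gT kpair k (fun X => @kfst X : {rmorphism kpair_sort X -> k X})
    (fun X Y f w => erefl) (fun X Y f w => erefl) (fun X Y f w => erefl).

Definition kpair_snd : tmorph kpair k :=
  @Tmorph gT kpair k (fun X => @ksnd X : {rmorphism kpair_sort X -> k X})
    (fun X Y f w => erefl) (fun X Y f w => erefl) (fun X Y f w => erefl).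

(** The projections of the kernel pair agree after phi, so they are equal when
    phi is monic; every pair of elements identified by phi is an element of the
    kernel pair. *)
Lemma tmonic_inj : tmonic phi -> forall X, injective (phi X).
Proof.
move=> mono X a b Eab; have abE : (a, b) \in kpair_pred X by apply/eqP.
by apply: (mono kpair kpair_fst kpair_snd (@kpairE) X (Kpair abE)).
Qed.

End KernelPair.

(** * Morphisms to fixed-point functors *)

Section Adjunct.
Variables (gT : finGroupType) (k : tambara gT) (S : gring gT).
Variable pi : {rmorphism underlying k -> S}.
Hypothesis piJ :
  forall g a, pi (gring_act (underlying k) g a) = gring_act S g (pi a).

Fact adjunct_subproof (X : gset gT) (a : k X) :
  [ffun x => pi (res k (orb x) a)] \in equivariant S X.
Proof. by apply/equivariantP=> x g; rewrite !ffunE res_orbJ piJ. Qed.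

Definition adjunct_map X (a : k X) : fixed S X := Fixed (adjunct_subproof a).

Fact adjunct_zmod X : zmod_morphism (@adjunct_map X).
Proof. by move=> a b; apply: fixedP => x; rewrite /= !ffunE !rmorphB. Qed.

Fact adjunct_monoid X : monoid_morphism (@adjunct_map X).
Proof.
by split=> [|a b]; apply: fixedP => x; rewrite /= !ffunE ?rmorph1 ?rmorphM.
Qed.

HB.instance Definition _ X :=
  GRing.isZmodMorphism.Build _ _ (@adjunct_map X) (@adjunct_zmod X).
HB.instance Definition _ X :=
  GRing.isMonoidMorphism.Build _ _ (@adjunct_map X) (@adjunct_monoid X).

Fact adjunct_res (X Y : gset gT) (f : gmap X Y) (a : k Y) :
  adjunct_map (res k f a) = res (fixed S) f (adjunct_map a).
Proof.
apply: fixedP => x; rewrite /= !ffunE; congr (pi _).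
by apply/esym/res_comp => g; rewrite /= gmapJ.
Qed.

Fact adjunct_tr (X Y : gset gT) (f : gmap X Y) (a : k X) :
  adjunct_map (tr k f a) = tr (fixed S) f (adjunct_map a).
Proof.
apply: fixedP => y; rewrite /= !ffunE res_orb_tr rmorph_sum.
by apply: eq_bigr => x _; rewrite ffunE.
Qed.

Fact adjunct_nm (X Y : gset gT) (f : gmap X Y) (a : k X) :
  adjunct_map (nm k f a) = nm (fixed S) f (adjunct_map a).
Proof.
apply: fixedP => y; rewrite /= !ffunE res_orb_nm rmorph_prod.
by apply: eq_bigr => x _; rewrite ffunE.
Qed.

(** The morphism k -> fixed S corresponding to an equivariant ring map
    k(G/e) -> S under the adjunction whose unit is [tunit]. *)
Definition adjunct : tmorph k (fixed S) :=
  Tmorph adjunct_res adjunct_tr adjunct_nm.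
End Adjunct.

Lemma fixed_nonzero (gT : finGroupType) (S : gring gT) :
  (1 : S) <> 0 -> tnonzero (fixed S).
Proof.
move=> nz; exists (gfree gT) => E.
have /= := congr1 (fun w : fixed_sort S (gfree gT) => fixed_val w 1%g) E.
by rewrite !ffunE.
Qed.

(** * Quotients by stable ideals *)

Definition is_ideal (R : comPzRingType) (I : R -> Prop) : Prop :=
  [/\ I 0, forall a b, I a -> I b -> I (a + b) & forall a b, I b -> I (a * b)].

Section Quotient.
Variables (gT : finGroupType) (R : gring gT) (I : zmodClosed R).
Hypothesis IM : forall a b, b \in I -> a * b \in I.
Hypothesis IJ : forall g a, a \in I -> gring_act R g a \in I.

(** The quotient group is a ring only because I is an ideal; recording that
    proof as an argument lets the ring structure be inferred from the type.
    Unlike the usual quotient by a proper ideal, it may be the zero ring. *)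
Definition gquot := (fun _ : (forall a b, b \in I -> a * b \in I) =>
  Quotient.quot I) IM.
HB.instance Definition _ := GRing.Zmodule.on gquot.

Definition gpi (a : R) : gquot := \pi_(Quotient.quot I) a.
Definition grepr (x : gquot) : R := repr (x : Quotient.quot I).

Lemma gpiP a b : (gpi a = gpi b) <-> (a - b \in I).
Proof. by rewrite Quotient.idealrBE; split=> /eqP. Qed.

Lemma greprK : cancel grepr gpi.
Proof. exact: reprK. Qed.

Lemma gpiK a : grepr (gpi a) - a \in I.
Proof. by apply/gpiP; rewrite greprK. Qed.

Fact gpi_zmod : zmod_morphism gpi.
Proof. by move=> a b; rewrite /gpi !piE. Qed.

HB.instance Definition _ := GRing.isZmodMorphism.Build _ _ gpi gpi_zmod.

Definition gquot_one : gquot := gpi 1.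
Definition gquot_mul (x y : gquot) : gquot := gpi (grepr x * grepr y).

Fact gpiM a b : gpi (a * b) = gquot_mul (gpi a) (gpi b).
Proof.
apply/esym/gpiP; set a' := grepr _; set b' := grepr _.
have -> : a' * b' - a * b = a' * (b' - b) + b * (a' - a).
  by rewrite !mulrBr mulrC [b * a]mulrC [b * a']mulrC addrA subrK mulrC.
by apply: rpredD; apply: IM; apply: gpiK.
Qed.

Fact gquot_mulA : associative gquot_mul.
Proof.
move=> x y z; rewrite -[x]greprK -[y]greprK -[z]greprK.
by rewrite -!gpiM mulrA.
Qed.

Fact gquot_mulC : commutative gquot_mul.
Proof. by move=> x y; rewrite /gquot_mul mulrC. Qed.

Fact gquot_mul1 : left_id gquot_one gquot_mul.
Proof. by move=> x; rewrite -[x]greprK -gpiM mul1r. Qed.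

Fact gquot_mulD : left_distributive gquot_mul +%R.
Proof.
move=> x y z; rewrite -[x]greprK -[y]greprK -[z]greprK.
by rewrite -raddfD -!gpiM -raddfD mulrDl.
Qed.

HB.instance Definition _ := GRing.Zmodule_isComPzRing.Build gquot
  gquot_mulA gquot_mulC gquot_mul1 gquot_mulD.

HB.instance Definition _ := GRing.isMonoidMorphism.Build _ _ gpi
  (erefl, gpiM).

Definition gquot_act (g : gT) (x : gquot) : gquot :=
  gpi (gring_act R g (grepr x)).

Lemma gpiJ g a : gpi (gring_act R g a) = gquot_act g (gpi a).
Proof. by apply/esym/gpiP; rewrite -rmorphB; apply/IJ/gpiK. Qed.

Fact gquot_act_zmod g : zmod_morphism (gquot_act g).
Proof.
move=> x y; rewrite -[x]greprK -[y]greprK.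
by rewrite -raddfB -!gpiJ -raddfB rmorphB.
Qed.

Fact gquot_act_monoid g : monoid_morphism (gquot_act g).
Proof.
split=> [|x y]; first by rewrite -(rmorph1 gpi) -gpiJ rmorph1.
rewrite -[x]greprK -[y]greprK.
by rewrite -rmorphM -!gpiJ -rmorphM rmorphM.
Qed.

HB.instance Definition _ g :=
  GRing.isZmodMorphism.Build _ _ (gquot_act g) (gquot_act_zmod g).
HB.instance Definition _ g :=
  GRing.isMonoidMorphism.Build _ _ (gquot_act g) (gquot_act_monoid g).

Fact gquot_act1 x : gquot_act 1%g x = x.
Proof. by rewrite -[x]greprK -gpiJ gring_act1. Qed.

Fact gquot_actM g h x : gquot_act (g * h)%g x = gquot_act h (gquot_act g x).
Proof. by rewrite -[x]greprK -!gpiJ gring_actM. Qed.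

Definition quotient_gring : gring gT :=
  @Gring gT gquot (fun g => gquot_act g) gquot_act1 gquot_actM.

End Quotient.

(** * Simplicity of the underlying ring of a field *)

Definition gsimple (gT : finGroupType) (R : gring gT) : Prop :=
  forall I : R -> Prop, is_ideal I ->
    (forall g a, I a -> I (gring_act R g a)) ->
    forall u, I u -> u <> 0 -> I 1.

(** A G-stable ideal not containing 1 is the kernel of a map onto a nonzero
    G-ring S, and the adjunct k -> fixed S is injective as k is a field; at
    level G/e it kills the ideal. *)
Lemma field_gsimple (gT : finGroupType) (k : tambara gT) :
  tambara_field k -> gsimple (underlying k).
Proof.
move=> [_ kmonic] I [I0 ID IM] IJ u Iu u0; apply: contrapT => nI1.
pose P : {pred underlying k} := fun a => `[< I a >].
have PE a : (a \in P) = `[< I a >] by [].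
have Pz : zmod_closed P.
  split=> [|a b]; rewrite !PE; first exact/asboolP.
  move=> /asboolP Ia /asboolP Ib; apply/asboolP/ID => //.
  by rewrite -mulN1r; apply: IM.
pose PI : zmodClosed (underlying k) :=
  HB.pack P (GRing.isZmodClosed.Build (underlying k) P Pz).
have PM a b : b \in PI -> a * b \in PI.
  by rewrite !PE => /asboolP Ib; apply/asboolP/IM.
have PJ g a : a \in PI -> gring_act (underlying k) g a \in PI.
  by rewrite !PE => /asboolP Ia; apply/asboolP/IJ.
pose S := quotient_gring PM PJ.
pose phi := @adjunct gT k S (gpi PM) (gpiJ PM PJ).
have S0 : (1 : S) <> 0.
  rewrite -(rmorph1 (gpi PM)) -(raddf0 (gpi PM)) => /gpiP.
  by rewrite subr0 => /asboolP.
have := tmonic_inj (kmonic _ phi (fixed_nonzero S0)).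
move=> /(_ (gfree gT) u 0) E; apply: u0; apply: E.
apply: fixedP => g; rewrite /= !ffunE raddf0 raddf0.
rewrite -(raddf0 (gpi PM)); apply/gpiP; rewrite subr0.
exact/asboolP/(IJ g u Iu).
Qed.

(** * The trace of a simple G-ring *)

Section Trace.
Variables (gT : finGroupType) (R : gring gT).
Implicit Types (g h s t : gT) (a b c r : R).
Local Notation "a ^^ g" := (gring_act R g a) (at level 30).

(** Call f : G -> R a relation when the sum of f g * r^g vanishes for all r. If
    the trace is zero, the constant 1 is a relation. Relations are closed under
    multiplication by R and by g |-> a^g, so multiplying by a^g - a^s produces
    relations that vanish at s and are multiplied by a - a^s at 1; as these
    displacements generate the unit ideal, the value at 1 can be brought back
    to 1. Doing so for all s <> 1 leaves the relation supported at 1 with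
    value 1, which reads r = 0 for all r. *)
Lemma trace_neq0 :
  (forall s, s != 1%g -> forall P : R -> Prop, is_ideal P ->
     (forall a, P (a - a ^^ s)) -> P 1) ->
  (1 : R) <> 0 -> exists c, \sum_(g : gT) c ^^ g <> 0.
Proof.
move=> gal nz; apply: contrapT => /forallNP tr0.
pose D (f : gT -> R) := forall r, \sum_g f g * r ^^ g = 0.
have [f [Df f1 fS]] : exists f, [/\ D f, f 1%g = 1 &
    forall s, s \in enum [set~ 1%g] -> f s = 0].
  have : all (fun s => s != 1%g) (enum [set~ (1 : gT)%g]).
    by apply/allP=> s; rewrite mem_enum !inE.
  elim: (enum _) => [_|s S IH /= /andP[s1 /IH [f [Df f1 fS]]]].
    exists (fun=> 1); split=> // r; rewrite /=; under eq_bigr do rewrite mul1r.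
    exact: (contrapT (tr0 r)).
  (* The values at 1 of the relations that vanish on s :: S form an ideal. *)
  pose P a := exists f, [/\ D f, f 1%g = a & forall t, t \in s :: S -> f t = 0].
  apply: (gal s s1 P) => [|a]; first split.
  - exists (fun=> 0); split=> // r; by rewrite big1 // => g _; rewrite mul0r.
  - move=> a b [f2 [Df2 <- fS2]] [f3 [Df3 <- fS3]].
    exists (fun g => f2 g + f3 g); split=> // [r|t tS].
      under eq_bigr do rewrite mulrDl.
      by rewrite big_split /= Df2 Df3 addr0.
    by rewrite fS2 // fS3 // addr0.
  - move=> a b [f2 [Df2 <- fS2]]; exists (fun g => a * f2 g).
    split=> // [r|t tS]; last by rewrite fS2 // mulr0.
    under eq_bigr do rewrite -mulrA.
    by rewrite -mulr_sumr Df2 mulr0.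
  exists (fun g => f g * (a ^^ g - a ^^ s)); split=> [r||t].
  - under eq_bigr => g _ do
      rewrite mulrBr mulrBl -mulrA -rmorphM -mulrA mulrCA.
    by rewrite sumrB -mulr_sumr !Df mulr0 subr0.
  - by rewrite f1 mul1r gring_act1.
  by rewrite inE => /predU1P[->|/fS ->]; rewrite ?mul0r // subrr mulr0.
have := Df 1; rewrite (bigD1 1%g) //= big1 => [|g g1].
  by rewrite f1 gring_act1 mulr1 addr0 => /nz.
by rewrite fS ?mul0r // mem_enum !inE.
Qed.

(** The principal ideal of the nonzero invariant element t = tr c is G-stable,
    so t has an inverse y; inverses of invariants are invariant, and
    tr (c * y) = t * y = 1. *)
Lemma trace_eq1 : gsimple R -> (exists c, \sum_(g : gT) c ^^ g <> 0) ->
  exists c, \sum_(g : gT) c ^^ g = 1.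
Proof.
move=> simp [c]; set t := \sum_(g : gT) _ => t0.
have tJ g : t ^^ g = t.
  rewrite /t rmorph_sum (reindex_inj (mulIg g^-1%g)) /=.
  by apply: eq_bigr => h _; rewrite -gring_actM mulgKV.
have [|||y tyE] := simp (fun x => exists y, x = t * y) _ _ t _ t0.
- split=> [|_ _ [x ->] [y ->]|a _ [x ->]]; first by exists 0; rewrite mulr0.
    by exists (x + y); rewrite mulrDr.
  by exists (a * x); rewrite mulrCA.
- by move=> g _ [x ->]; exists (x ^^ g); rewrite rmorphM /= tJ.
- by exists 1; rewrite mulr1.
have yJ g : y ^^ g = y.
  have tyg : 1 = t * y ^^ g by rewrite -{1}(tJ g) -rmorphM -tyE rmorph1.
  by rewrite -[LHS]mul1r tyE mulrAC -tyg mul1r.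
exists (c * y); under eq_bigr do rewrite rmorphM /= yJ.
by rewrite -mulr_suml -tyE.
Qed.

End Trace.

(** Simplicity applies to the largest G-stable ideal inside P, made of the x all
    of whose conjugates lie in P. Since G is abelian, the conjugates of a - a^s
    are again of this form, so it contains all of these; they are not all zero,
    for otherwise the generator s of G would act trivially. *)
Lemma ideal_of_displacements (gT : finGroupType) (R : gring gT) :
  prime #|[set: gT]| -> gsimple R ->
  (exists (g : gT) (a : R), gring_act R g a <> a) ->
  forall s : gT, s != 1%g -> forall P : R -> Prop, is_ideal P ->
  (forall a, P (a - gring_act R s a)) -> P 1.
Proof.
move=> prG simp [g [a ga]] s s1 P [P0 PD PM] Ps.
have [b sb] : exists b, b - gring_act R s b <> 0.
  apply: contrapT => /forallNP triv; apply: ga.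
  have sfix b : gring_act R s b = b.
    by have /contrapT/subr0_eq := triv b.
  have : g \in <[s]>%g.
    suff /eqP-> : <[s]>%g == [set: gT] by rewrite inE.
    rewrite eqEcard subsetT dvdn_leq ?order_gt0 //.
    by rewrite -orderE (prime_nt_dvdP prG _ (order_dvdG (in_setT s))) ?order_eq1.
  case/cycleP=> n ->; elim: n => [|n IH]; first by rewrite gring_act1.
  by rewrite expgS gring_actM sfix.
have comm h : (h * s = s * h)%g.
  by have /centsP := cyclic_abelian (prime_cyclic prG); apply; rewrite inE.
suff /(_ 1%g) : forall h, P (gring_act R h 1) by rewrite rmorph1.
apply: (simp (fun x => forall h, P (gring_act R h x)) _ _ _ _ sb).
- split=> [h|x y Px Py h|x y Py h].
  + by rewrite rmorph0.
  + by rewrite rmorphD; apply: PD.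
  + by rewrite rmorphM; apply: PM.
- by move=> h x Px h'; rewrite -gring_actM.
by move=> h; rewrite rmorphB /= -gring_actM -comm gring_actM.
Qed.

(** * Surjectivity of the unit *)

(** By the double coset formula, the restriction along y of the transfer along x
    of c * b x is the sum over the g with x g = y of c^g * (b x)^g, and
    (b x)^g = b y by equivariance. Every g in G occurs for exactly one x, so
    summing over x gives tr c * b y. *)
Lemma tunit_surj (gT : finGroupType) (k : tambara gT) :
  (exists c : underlying k, \sum_g gring_act (underlying k) g c = 1) ->
  forall X (b : fixed (underlying k) X), exists a : k X, tunit k X a = b.
Proof.
move=> [c trc] X b.
pose F x := c * fixed_val b x.
exists (\sum_(x : X) tr k (orb x) (F x)).
apply: fixedP => y; rewrite /= ffunE rmorph_sum /=.
transitivity (\sum_(x : X) \sum_(g : gT | gact x g == y)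
    gring_act (underlying k) g c * fixed_val b y).
  apply: eq_bigr => x _; rewrite res_orb_tr; apply: eq_bigr => g /eqP <-.
  by rewrite fixedJ -rmorphM.
rewrite (exchange_big_dep xpredT) //=.
transitivity (\sum_(g : gT) gring_act (underlying k) g c * fixed_val b y).
  apply: eq_bigr => g _; rewrite (big_pred1 (gact y g^-1%g)) // => x.
  exact: (canF_eq (actK (gset_act X) g)).
by rewrite -mulr_suml trc mul1r.
Qed.

Theorem proposition1p4 (p : nat) (gT : finGroupType) (hp : prime p)
  (hG : #|[set: gT]| = p) (k : tambara gT) (hk : tambara_field k)
  (hact : exists (g : gT) (a : underlying k), gring_act (underlying k) g a <> a) :
  tiso (tunit k).
Proof.
have nz : (1 : underlying k) <> 0.
  have [g [a ga]] := hact; move=> E; apply: ga.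
  by rewrite -[LHS]mulr1 -[RHS]mulr1 E !mulr0.
have simp := field_gsimple hk.
apply: bijective_tiso.
  exact: (tmonic_inj (hk.2 _ (tunit k) (fixed_nonzero nz))).
apply/tunit_surj/trace_eq1/trace_neq0 => //.
by apply: ideal_of_displacements; rewrite ?hG.
Qed.
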